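(* Consider the L-SVRG iteration with $\psi\equiv 0$ (defined in the context) with stepsize $\eta>0$, probability $p\in(0,1]$ and sampling (or sampling with replacement) $S$. Let $f$ be $L_f$-smooth (possibly nonconvex) with $L_f>0$, and suppose there is a constant $\mathcal{L}_3>0$ such that for all $x,y\in\mathbb{R}^d$ $$\mathbb{E}\left[\left\|\tfrac1n(\mathbf{G}(x)-\mathbf{G}(y))\theta_S\mathbf{I}_Se-\tfrac1n(\mathbf{G}(x)-\mathbf{G}(y))e\right\|^2\right]\le\mathcal{L}_3\|x-y\|^2.$$ Let $\Psi^k=f(x^k)+\alpha\|x^k-w^k\|^2$ with $\alpha=3\eta^2L_f\mathcal{L}_3/p$. If $$\eta\le\min\left\{\frac{1}{4L_f},\ \frac{p^{2/3}}{36^{1/3}(L_f\mathcal{L}_3)^{1/3}},\ \frac{\sqrt p}{\sqrt{6\mathcal{L}_3}}\right\},$$ then for every $k\ge 0$ $$\mathbb{E}_k[\Psi^{k+1}]\le\Psi^k-\frac\eta4\|\nabla f(x^k)\|^2.$$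
   Context: Problem: minimize $f=\frac1n\sum_{i=1}^nf_i$ over $\mathbb{R}^d$, where each $f_i:\mathbb{R}^d\to\mathbb{R}$ is differentiable; $f$ has at least one global minimizer. $f$ is $L_f$-smooth means $\nabla f$ is $L_f$-Lipschitz. Sampling: $[n]=\{1,\dots,n\}$ and $e\in\mathbb{R}^n$ is the all-ones vector. $S$ is one of the following. (a) A proper sampling: a random subset of $[n]$ with $\mathbb{P}[i\in S]>0$ for all $i$, together with real weights $\theta_C^i$ ($i\in[n]$, $C\subseteq[n]$). (b) A sampling with replacement: $S$ consists of $\tau$ independent copies of an index drawn from a distribution on $[n]$ with probabilities $\tilde p_i>0$ (repetitions counted), with weights $\theta_S^i=1/(\tau\tilde p_i)$. $\theta_S$ is the $n\times n$ diagonal matrix with diagonal entries $\theta_S^i$, and $\mathbf{I}_S$ is the diagonal matrix whose $i$-th diagonal entry is the number of copies of $i$ in $S$. It is assumed that $\mathbb{E}[\theta_S\mathbf{I}_S]e=e$ (automatic in case (b)). $\mathbf{G}(x)=[\nabla f_1(x),\dots,\nabla f_n(x)]\in\mathbb{R}^{d\times n}$, so $\frac1n\mathbf{G}(x)\theta_S\mathbf{I}_Se=\frac1n\sum_{i\in S}\theta_S^i\nabla f_i(x)$ with multiplicities. L-SVRG with $\psi\equiv0$: $x^0=w^0\in\mathbb{R}^d$. For $k=0,1,2,\dots$: draw $S_k$ as a fresh independent copy of $S$; set $g^k=\frac1n(\mathbf{G}(x^k)-\mathbf{G}(w^k))\theta_{S_k}\mathbf{I}_{S_k}e+\frac1n\mathbf{G}(w^k)e$;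 set $x^{k+1}=x^k-\eta g^k$; set $w^{k+1}=x^k$ with probability $p$ and $w^{k+1}=w^k$ with probability $1-p$ (by an independent coin flip). $\mathbb{E}_k[\cdot]$ is the expectation conditional on $x^k$ and $w^k$. *)

(* Defs.v *)
From HB Require Import structures.
From mathcomp Require Import all_boot all_order all_algebra.
From mathcomp Require Import all_classical all_reals all_analysis.

Set Implicit Arguments.
Unset Strict Implicit.
Unset Printing Implicit Defensive.

Import Order.TTheory GRing.Theory Num.Theory.
Import numFieldNormedType.Exports.

Local Open Scope classical_set_scope.
Local Open Scope ring_scope.

(* The library norm on 'cV[R]_d is the sup norm, so the Euclidean norm is
   introduced separately; differentiability does not depend on this choice. *)
Definition enorm (R : realType) (d : nat) (x : 'cV[R]_d) : R :=
  Num.sqrt (\sum_(i < d) x i 0 ^+ 2).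

(* Meaningful only where f is differentiable. *)
Definition grad (R : realType) (d : nat) (f : 'cV[R]_d -> R) (x : 'cV[R]_d) :
  'cV[R]_d := \col_i 'D_(delta_mx i 0) f x.

Definition smooth (R : realType) (d : nat) (L : R) (f : 'cV[R]_d -> R) : Prop :=
  forall x y, enorm (grad f x - grad f y) <= L * enorm (x - y).

Definition avg (R : realType) (n d : nat) (f : 'I_n -> 'cV[R]_d -> R)
  (x : 'cV[R]_d) : R := n%:R^-1 * \sum_(i < n) f i x.

Definition Gmx (R : realType) (n d : nat) (f : 'I_n -> 'cV[R]_d -> R)
  (x : 'cV[R]_d) : 'M[R]_(d, n) := \matrix_(j, i) grad (f i) x j 0.

Definition ones (R : realType) (n : nat) : 'cV[R]_n := const_mx 1.

(* [ProperSampling q theta]: S = C with probability q C, with weights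
   theta_C^i = theta C i.
   [WithReplacement tau pt]: S is a tau-tuple of independent indices, each
   equal to i with probability pt i. *)
Inductive sampling (R : realType) (n : nat) : Type :=
| ProperSampling of ({set 'I_n} -> R) & ({set 'I_n} -> 'I_n -> R)
| WithReplacement of nat & ('I_n -> R).

Definition valid_sampling (R : realType) (n : nat) (S : sampling R n) : Prop :=
  match S with
  | ProperSampling q _ =>
      [/\ forall C, 0 <= q C, \sum_C q C = 1
        & forall i, 0 < \sum_(C : {set 'I_n} | i \in C) q C]
  | WithReplacement tau pt =>
      [/\ (0 < tau)%N, forall i, 0 < pt i & \sum_i pt i = 1]
  end.

Definition outcome (R : realType) (n : nat) (S : sampling R n) : finType :=
  match S with
  | ProperSampling _ _ => {set 'I_n}
  | WithReplacement tau _ => tau.-tuple 'I_n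
  end.

Definition law (R : realType) (n : nat) (S : sampling R n) : outcome S -> R :=
  match S return outcome S -> R with
  | ProperSampling q _ => q
  | WithReplacement tau pt => fun t => \prod_(j < tau) pt (tnth t j)
  end.

Definition copies (R : realType) (n : nat) (S : sampling R n) :
  outcome S -> 'I_n -> nat :=
  match S return outcome S -> 'I_n -> nat with
  | ProperSampling _ _ => fun C i => (i \in C) : nat
  | WithReplacement tau _ => fun t i => count_mem i t
  end.

Definition weight (R : realType) (n : nat) (S : sampling R n) :
  outcome S -> 'I_n -> R :=
  match S return outcome S -> 'I_n -> R with
  | ProperSampling _ theta => theta
  | WithReplacement tau pt => fun _ i => (tau%:R * pt i)^-1
  end.

Definition theta_mx (R : realType) (n : nat) (S : sampling R n)
  (s : outcome S) : 'M[R]_n := diag_mx (\row_i weight s i).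

Definition I_mx (R : realType) (n : nat) (S : sampling R n)
  (s : outcome S) : 'M[R]_n := diag_mx (\row_i (copies s i)%:R).

Definition unbiased (R : realType) (n : nat) (S : sampling R n) : Prop :=
  (\sum_(s : outcome S) law s *: (theta_mx s *m I_mx s)) *m ones R n = ones R n.

Definition sampling_variance_bound (R : realType) (n d : nat)
  (f : 'I_n -> 'cV[R]_d -> R) (S : sampling R n) (L3 : R) : Prop :=
  forall x y : 'cV[R]_d,
    \sum_(s : outcome S) law s *
      enorm (n%:R^-1 *: ((Gmx f x - Gmx f y) *m theta_mx s *m I_mx s *m ones R n)
             - n%:R^-1 *: ((Gmx f x - Gmx f y) *m ones R n)) ^+ 2
    <= L3 * enorm (x - y) ^+ 2.

Definition lsvrg_dir (R : realType) (n d : nat) (f : 'I_n -> 'cV[R]_d -> R)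
  (S : sampling R n) (x w : 'cV[R]_d) (s : outcome S) : 'cV[R]_d :=
  n%:R^-1 *: ((Gmx f x - Gmx f w) *m theta_mx s *m I_mx s *m ones R n)
  + n%:R^-1 *: (Gmx f w *m ones R n).

(* The pair (x^k, w^k) obtained from the draws s 0, s 1, ... and the coin flips
   b 0, b 1, ... *)
Fixpoint lsvrg (R : realType) (n d : nat) (f : 'I_n -> 'cV[R]_d -> R)
  (S : sampling R n) (eta : R) (x0 : 'cV[R]_d)
  (s : nat -> outcome S) (b : nat -> bool) (k : nat) : 'cV[R]_d * 'cV[R]_d :=
  match k with
  | 0 => (x0, x0)
  | k'.+1 =>
      let: (x, w) := lsvrg f eta x0 s b k' in
      (x - eta *: lsvrg_dir f x w (s k'), if b k' then x else w)
  end.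

Definition lyapunov (R : realType) (d : nat) (F : 'cV[R]_d -> R) (alpha : R)
  (z : 'cV[R]_d * 'cV[R]_d) : R := F z.1 + alpha * enorm (z.1 - z.2) ^+ 2.

(* All events of the form [X in B]; used for X with values in a finite set. *)
Definition events (T U : Type) (X : T -> U) : set_system T :=
  preimage_set_system setT X setT.

Definition mutually_independent (dT : measure_display) (T : measurableType dT)
  (R : realType) (P : probability T R) (I : choiceType)
  (E : I -> set_system T) : Prop :=
  forall (J : seq I) (A : I -> set T), uniq J ->
    (forall i, i \in J -> E i (A i)) ->
    P (\bigcap_(i in [set` J]) A i) = (\prod_(i <- J) P (A i))%E.

(* The S_k have the law of the sampling, the b_k are Bernoulli(p), and all of
   S_0, b_0, S_1, b_1, ... are mutually independent. *)
Definition lsvrg_randomness (dT : measure_display) (T : measurableType dT)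
  (R : realType) (P : probability T R) (n : nat) (S : sampling R n) (p : R)
  (Sk : nat -> T -> outcome S) (bk : nat -> T -> bool) : Prop :=
  [/\ forall k, events (Sk k) `<=` measurable,
      forall k, events (bk k) `<=` measurable,
      forall k s, P (Sk k @^-1` [set s]) = (law s)%:E,
      forall k, P (bk k @^-1` [set true]) = p%:E
    & mutually_independent P
        (fun j : nat + nat =>
           match j with inl k => events (Sk k) | inr k => events (bk k) end)].

Definition sigma_of (T : Type) (U : topologicalType) (Z : T -> U) :
  set_system T := preimage_set_system setT Z <<s @open U >>.

(* Y is a version of the conditional expectation E[X | Z]. *)
Definition is_cond_exp (dT : measure_display) (T : measurableType dT)
  (R : realType) (P : probability T R) (U : topologicalType)
  (Z : T -> U) (X Y : T -> R) : Prop :=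
  [/\ P.-integrable setT (EFin \o X),
      P.-integrable setT (EFin \o Y),
      forall B : set R, measurable B -> sigma_of Z (Y @^-1` B)
    & forall A, sigma_of Z A ->
        (\int[P]_(t in A) (Y t)%:E = \int[P]_(t in A) (X t)%:E)%E].

(* Main.v *)
Require Import Defs.
From HB Require Import structures.
From mathcomp Require Import all_boot all_order all_algebra.
From mathcomp Require Import all_classical all_reals all_analysis.
From mathcomp Require Import ring lra.
Import Order.TTheory GRing.Theory Num.Theory.
Import numFieldNormedType.Exports.
Local Open Scope classical_set_scope.
Local Open Scope ring_scope.

(** The proof separates a deterministic one-step estimate from the
    identification of the conditional expectation.

    Fix a state [(x, w)], write [D = |x - w|^2], and let [g] be the random
    direction. Since the sampling is unbiased, [g] has mean [grad F(x)], where
    [F = avg f], and the variance bound at [(x, w)] says that its variance is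
    at most [L3 D]; hence [E|g|^2 <= |grad F(x)|^2 + L3 D]. The descent lemma
    bounds [F(x - eta g)]. The squared distance to the new reference point is
    [|eta g|^2] with probability [p] and [|x - w - eta g|^2] with probability
    [1 - p]. The cross term [- 2 eta <x - w, grad F(x)>] is handled by Young's
    inequality, which bounds it by [p/2 D + 2 eta^2/p |grad F(x)|^2], so that
    the squared distance is still multiplied by at most [1 - p/2]. With [alpha = 3 eta^2 L L3 / p], the bound
    [6 L3 eta^2 <= p] makes this contraction absorb the variance
    ([contraction_coef]), and the bounds [4 L eta <= 1] and
    [36 L L3 eta^3 <= p^2] keep the coefficient of [|grad F(x)|^2] at most
    [- eta/4] ([gradient_coef]). The outcome is [lyapunov_decrease].

    The state [z k] is a function of the first [k] draws and coin flips, which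
    range over a finite type. Independence gives the joint law of these
    variables ([history_prob]), so the [k]-th draw and flip are independent of
    the history, and a version of the conditional expectation is obtained by
    averaging over them with the state frozen ([cond_exp_freezing]). As the
    state takes finitely many values, any version is constant on the atoms
    [z k = v], so two versions can differ only on atoms of probability zero
    ([cond_exp_unique_fin]). The estimate for the averaged version therefore
    holds almost surely for all of them. *)

Set Implicit Arguments.
Unset Strict Implicit.
Unset Printing Implicit Defensive.

(** * Euclidean geometry *)

(** The Euclidean inner product of column vectors. *)
Definition dot (R : realType) (d : nat) (x y : 'cV[R]_d) : R :=
  \sum_(i < d) x i 0 * y i 0.

Lemma enorm_sqr (R : realType) (d : nat) (x : 'cV[R]_d) :
  enorm x ^+ 2 = dot x x.
Proof.
by rewrite /enorm sqr_sqrtr // sumr_ge0 // => i _; rewrite sqr_ge0.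
Qed.

Lemma enorm_ge0 (R : realType) (d : nat) (x : 'cV[R]_d) : 0 <= enorm x.
Proof. exact: sqrtr_ge0. Qed.

Lemma dot_ge0 (R : realType) (d : nat) (x : 'cV[R]_d) : 0 <= dot x x.
Proof. by rewrite -enorm_sqr sqr_ge0. Qed.

Lemma dotC (R : realType) (d : nat) (x y : 'cV[R]_d) : dot x y = dot y x.
Proof. by apply: eq_bigr => i _; rewrite mulrC. Qed.

Lemma dotDl (R : realType) (d : nat) (x y z : 'cV[R]_d) :
  dot (x + y) z = dot x z + dot y z.
Proof. by rewrite -big_split; apply: eq_bigr => i _; rewrite mxE mulrDl. Qed.

Lemma dotZl (R : realType) (d : nat) (a : R) (x y : 'cV[R]_d) :
  dot (a *: x) y = a * dot x y.
Proof. by rewrite mulr_sumr; apply: eq_bigr => i _; rewrite mxE mulrA. Qed.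

Lemma dotNl (R : realType) (d : nat) (x y : 'cV[R]_d) :
  dot (- x) y = - dot x y.
Proof. by rewrite -scaleN1r dotZl mulN1r. Qed.

Lemma dotDr (R : realType) (d : nat) (x y z : 'cV[R]_d) :
  dot x (y + z) = dot x y + dot x z.
Proof. by rewrite !(dotC x) dotDl. Qed.

Lemma dotZr (R : realType) (d : nat) (a : R) (x y : 'cV[R]_d) :
  dot x (a *: y) = a * dot x y.
Proof. by rewrite !(dotC x) dotZl. Qed.

Lemma dotNr (R : realType) (d : nat) (x y : 'cV[R]_d) :
  dot x (- y) = - dot x y.
Proof. by rewrite !(dotC x) dotNl. Qed.

Definition dotE := (dotDl, dotDr, dotZl, dotZr, dotNl, dotNr).

Lemma dot_suml (R : realType) (d : nat) (I : finType) (F : I -> 'cV[R]_d)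
  (y : 'cV[R]_d) : dot (\sum_i F i) y = \sum_i dot (F i) y.
Proof.
apply: (big_morph (fun x => dot x y)) => [u v|]; first exact: dotDl.
by rewrite /dot big1 // => i _; rewrite mxE mul0r.
Qed.

Lemma dot_sumr (R : realType) (d : nat) (I : finType) (F : I -> 'cV[R]_d)
  (y : 'cV[R]_d) : dot y (\sum_i F i) = \sum_i dot y (F i).
Proof. by rewrite dotC dot_suml; apply: eq_bigr => i _; rewrite dotC. Qed.

Lemma enormB_sqr (R : realType) (d : nat) (x y : 'cV[R]_d) :
  enorm (x - y) ^+ 2 = enorm x ^+ 2 - 2 * dot x y + enorm y ^+ 2.
Proof. by rewrite !enorm_sqr !dotE (dotC y x); ring. Qed.

Lemma enormZ_sqr (R : realType) (d : nat) (a : R) (x : 'cV[R]_d) :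
  enorm (a *: x) ^+ 2 = a ^+ 2 * enorm x ^+ 2.
Proof. by rewrite !enorm_sqr dotZl dotZr; ring. Qed.

(** Young's inequality; it stands in for Cauchy-Schwarz throughout. *)
Lemma dot_young (R : realType) (d : nat) (c : R) (x y : 'cV[R]_d) :
  0 < c -> 2 * dot x y <= c^-1 * dot x x + c * dot y y.
Proof.
move=> c0; rewrite -subr_ge0.
have -> : c^-1 * dot x x + c * dot y y - 2 * dot x y =
          c^-1 * dot (x - c *: y) (x - c *: y).
  by rewrite !dotE (dotC y x); field; rewrite gt_eqF.
by rewrite mulr_ge0 ?dot_ge0 // invr_ge0 ltW.
Qed.

(** * Gradients and smoothness *)

(** The gradient represents the derivative: [D_v f(x) = <grad f x, v>]. *)
Lemma derive_grad (R : realType) (d : nat) (f : 'cV[R]_d -> R)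
  (x v : 'cV[R]_d) : differentiable f x -> 'D_v f x = dot (grad f x) v.
Proof.
move=> df; rewrite deriveE // {1}[v]matrix_sum_delta linear_sum.
apply: eq_bigr => i _; rewrite big_ord1 linearZ mxE /= deriveE //.
by rewrite mulrC.
Qed.

Lemma is_derive_line (R : realType) (d : nat) (f : 'cV[R]_d -> R)
  (x v : 'cV[R]_d) (t : R) : derivable f (x + t *: v) v ->
  is_derive t 1 (fun s => f (x + s *: v)) ('D_v f (x + t *: v)).
Proof.
have E : (fun h => h^-1 *: (((fun s => f (x + s *: v)) \o shift t) (h *: 1) -
                             f (x + t *: v))) =
         (fun h : R => h^-1 *: ((f \o shift (x + t *: v)) (h *: v) -
                            f (x + t *: v))).
  apply/funext => h /=; congr (_ *: (f _ - _)).
  by rewrite scalerDl addrCA [h *: 1](mulr1 h).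
by move=> df; split; rewrite /derivable /derive E.
Qed.

(** The descent lemma: the mean value theorem is applied on [0, 1] to
    [f(x + t v) - t <grad f(x), v> - L/2 t^2 |v|^2] with [v = y - x], whose
    derivative is nonpositive. *)
Lemma smooth_descent (R : realType) (d : nat) (L : R) (f : 'cV[R]_d -> R)
  (x y : 'cV[R]_d) : 0 < L -> (forall z, differentiable f z) -> smooth L f ->
  f y <= f x + dot (grad f x) (y - x) + L / 2 * enorm (y - x) ^+ 2.
Proof.
move=> L0 df sf; set v := y - x; set N := enorm v ^+ 2.
pose dphi (t : R) := dot (grad f (x + t *: v)) v - dot (grad f x) v - L * N * t.
pose phi (t : R) := f (x + t *: v) - t * dot (grad f x) v - L / 2 * N * t ^+ 2.
have phi' (t : R) : is_derive t 1 phi (dphi t).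
  have dl : is_derive t 1 (fun s => f (x + s *: v)) (dot (grad f (x + t *: v)) v).
    rewrite -derive_grad //; apply: is_derive_line.
    exact: diff_derivable.
  apply: is_derive_eq.
  rewrite /dphi !scaler0 !add0r /GRing.scale /=.
  by field.
have cphi : {within `[0, 1], continuous phi}.
  apply: derivable_within_continuous => t _.
  by case: (phi' t).
have [c cin] := MVT ltr01 (fun t _ => phi' t) cphi.
rewrite /phi subr0 mulr1 scale0r scale1r !addr0 !mul0r expr0n /= mulr0 !subr0.
have -> : x + v = y by rewrite addrC subrK.
rewrite expr1n mulr1 mul1r.
move: cin; rewrite in_itv /= => /andP[c0 c1] E.
suff : dphi c <= 0 by lra.
(* The parameter [L c] balances the two halves: by smoothness each is at most
   [L c |v|^2]. *)
have := dot_young (grad f (x + c *: v) - grad f x) v (mulr_gt0 L0 c0).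
have := sf (x + c *: v) x; rewrite addrAC subrr add0r => s.
have {s} : enorm (grad f (x + c *: v) - grad f x) ^+ 2
    <= (L * enorm (c *: v)) ^+ 2.
  by rewrite lerXn2r // ?nnegrE ?mulr_ge0 ?enorm_ge0 // ltW.
rewrite exprMn !enorm_sqr [dot (c *: v) _]dotZl dotZr -!enorm_sqr -/N => s.
rewrite dotDl dotNl /dphi => h.
have e : (L * c)^-1 * (L ^+ 2 * (c * (c * N))) = L * c * N.
  by field; rewrite !gt_eqF.
have : (L * c)^-1 * enorm (grad f (x + c *: v) - grad f x) ^+ 2 <= L * c * N.
  by rewrite -e ler_pM2l // invr_gt0 mulr_gt0.
lra.
Qed.

Lemma avgE (R : realType) (n d : nat) (f : 'I_n -> 'cV[R]_d -> R) :
  avg f = n%:R^-1 *: (\sum_(i < n) f i).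
Proof. by apply/funext => y; rewrite /avg /GRing.scale /= fct_sumE. Qed.

Lemma differentiable_avg (R : realType) (n d : nat)
  (f : 'I_n -> 'cV[R]_d -> R) (x : 'cV[R]_d) :
  (forall i, differentiable (f i) x) -> differentiable (avg f) x.
Proof.
move=> df; rewrite avgE.
by apply: differentiableZ; apply: differentiable_sum.
Qed.

Lemma grad_avg (R : realType) (n d : nat)
  (f : 'I_n -> 'cV[R]_d -> R) (x : 'cV[R]_d) :
  (forall i, differentiable (f i) x) ->
  grad (avg f) x = n%:R^-1 *: (Gmx f x *m ones R n).
Proof.
move=> df; rewrite avgE.
have dd i v : derivable (f i) x v by apply: diff_derivable.
apply/matrixP => j k; rewrite ord1 !mxE deriveZ; last exact: derivable_sum.
rewrite derive_sum //; congr (_ * _); apply: eq_bigr => i _.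
by rewrite !mxE mulr1.
Qed.

(** * The one-step estimate *)

(** [E|g|^2 = |E g|^2 + E|g - E g|^2]. *)
Lemma bias_variance (R : realType) (d : nat) (O : finType) (q : O -> R)
  (g : O -> 'cV[R]_d) (m : 'cV[R]_d) :
  \sum_s q s = 1 -> \sum_s q s *: g s = m ->
  \sum_s q s * enorm (g s) ^+ 2 =
  enorm m ^+ 2 + \sum_s q s * enorm (g s - m) ^+ 2.
Proof.
move=> q1 gm.
have E : \sum_s q s * dot m (g s) = dot m m.
  by rewrite -{3}gm dot_sumr; apply: eq_bigr => s _; rewrite dotZr.
under [in RHS]eq_bigr => s _.
  rewrite enormB_sqr dotC (_ : _ * _ = q s * enorm (g s) ^+ 2
    - 2 * (q s * dot m (g s)) + q s * enorm m ^+ 2); last by ring.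
  over.
rewrite !big_split sumrN -mulr_sumr -mulr_suml q1 /= E enorm_sqr; ring.
Qed.

Lemma lyapunov_coef_ge0 (R : realType) (L L3 eta p alpha : R) :
  0 < L -> 0 < L3 -> 0 < p -> alpha = 3 * eta ^+ 2 * L * L3 / p -> 0 <= alpha.
Proof.
move=> L0 L30 p0 ->; apply: divr_ge0 (ltW p0); apply: mulr_ge0 (ltW L30).
by apply: mulr_ge0 (ltW L0); apply: mulr_ge0 (sqr_ge0 _).
Qed.

(** The variance contributes at most [alpha p/2] to the factor of
    [|x - w|^2]. *)
Lemma contraction_coef (R : realType) (L L3 eta p alpha : R) :
  0 < L -> 0 < L3 -> 0 < p -> 6 * L3 * eta ^+ 2 <= p ->
  alpha = 3 * eta ^+ 2 * L * L3 / p ->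
  (L / 2 * eta ^+ 2 + alpha * eta ^+ 2) * L3 <= alpha * (p / 2).
Proof.
move=> L0 L30 p0 h6 alphaE.
have ap : alpha * p = 3 * eta ^+ 2 * L * L3 by rewrite alphaE mulfVK // gt_eqF.
have a0 := lyapunov_coef_ge0 L0 L30 p0 alphaE.
have := mulr_ge0 a0 (ltW p0); have := ler_wpM2l a0 h6; lra.
Qed.

(** A bound on the positive contributions to the factor of [|grad F(x)|^2],
    to be set against [- eta]. *)
Lemma gradient_coef (R : realType) (L L3 eta p alpha : R) :
  0 < L -> 0 < L3 -> 0 < eta -> 0 < p -> p <= 1 ->
  4 * L * eta <= 1 -> 36 * (L * L3) * eta ^+ 3 <= p ^+ 2 ->
  alpha = 3 * eta ^+ 2 * L * L3 / p ->
  L / 2 * eta ^+ 2 + alpha * eta ^+ 2 + alpha * (2 * eta ^+ 2 / p)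
    <= 3 / 4 * eta.
Proof.
move=> L0 L30 e0 p0 p1 h4 h36 alphaE.
have a0 := lyapunov_coef_ge0 L0 L30 p0 alphaE.
have h : alpha * eta ^+ 2 / p <= eta / 12.
  have -> : alpha * eta ^+ 2 / p =
      eta / 12 * (36 * (L * L3) * eta ^+ 3 / p ^+ 2).
    by rewrite alphaE; field; rewrite gt_eqF.
  by rewrite ger_pMr ?divr_gt0 // ler_pdivrMr ?mul1r // exprn_gt0.
have h' : alpha * eta ^+ 2 <= alpha * eta ^+ 2 / p.
  by rewrite ler_pdivlMr // ler_piMr // mulr_ge0 // sqr_ge0.
have h'' : L / 2 * eta ^+ 2 <= eta / 8.
  have := ler_wpM2r (ltW e0) h4; lra.
have -> : alpha * (2 * eta ^+ 2 / p) = 2 * (alpha * eta ^+ 2 / p) by ring.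
lra.
Qed.

(** One step of the method with an abstract gradient estimator [g], unbiased
    and of variance at most [L3 |x - w|^2]. *)
Lemma lyapunov_decrease (R : realType) (d : nat) (F : 'cV[R]_d -> R)
  (L L3 eta p alpha : R) (O : finType) (q : O -> R) (g : O -> 'cV[R]_d)
  (x w : 'cV[R]_d) :
  (forall z, differentiable F z) -> smooth L F ->
  0 < L -> 0 < L3 -> 0 < eta -> 0 < p -> p <= 1 ->
  4 * L * eta <= 1 -> 36 * (L * L3) * eta ^+ 3 <= p ^+ 2 ->
  6 * L3 * eta ^+ 2 <= p ->
  (forall s, 0 <= q s) -> \sum_s q s = 1 ->
  \sum_s q s *: g s = grad F x ->
  \sum_s q s * enorm (g s - grad F x) ^+ 2 <= L3 * enorm (x - w) ^+ 2 ->
  alpha = 3 * eta ^+ 2 * L * L3 / p ->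
  \sum_s q s * (p * lyapunov F alpha (x - eta *: g s, x) +
                (1 - p) * lyapunov F alpha (x - eta *: g s, w))
  <= lyapunov F alpha (x, w) - eta / 4 * enorm (grad F x) ^+ 2.
Proof.
move=> dF sF L0 L30 e0 p0 p1 h4 h36 h6 q0 q1 gm gv alphaE.
set D := enorm (x - w) ^+ 2; set m := grad F x; set r := x - w.
set K := L / 2 * eta ^+ 2 + alpha * eta ^+ 2.
have a0 := lyapunov_coef_ge0 L0 L30 p0 alphaE.
have step s : p * lyapunov F alpha (x - eta *: g s, x) +
              (1 - p) * lyapunov F alpha (x - eta *: g s, w)
   <= F x + alpha * (1 - p) * D - eta * dot m (g s)
      - alpha * (1 - p) * (2 * eta) * dot r (g s) + K * enorm (g s) ^+ 2.
  have := smooth_descent x (x - eta *: g s) L0 dF sF.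
  rewrite /lyapunov /= [x - _ - x]addrAC subrr add0r -/m.
  rewrite [x - _ - w]addrAC -/r [enorm (- _) ^+ 2]enorm_sqr dotNl !dotNr opprK.
  rewrite dotZl !dotZr enormB_sqr dotZr enormZ_sqr -enorm_sqr -/D /K; lra.
apply: (le_trans (ler_sum _ (fun s _ => ler_wpM2l (q0 s) (step s)))).
rewrite (eq_bigr (fun s => q s * (F x + alpha * (1 - p) * D)
    - eta * (q s * dot m (g s))
    - alpha * (1 - p) * (2 * eta) * (q s * dot r (g s))
    + K * (q s * enorm (g s) ^+ 2))); last by move=> s _; ring.
have E v : \sum_s q s * dot v (g s) = dot v m.
  by rewrite /m -gm dot_sumr; apply: eq_bigr => s _; rewrite dotZr.
rewrite !big_split /= !sumrN -mulr_suml -!mulr_sumr q1 !E (bias_variance q1 gm).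
rewrite -/m /lyapunov /= -/r -/D mul1r -enorm_sqr.
set M := enorm m ^+ 2; set V := \sum_s _.
have VD : V <= L3 * D by [].
have K0 : 0 <= K.
  apply: addr_ge0; last exact: mulr_ge0 a0 (sqr_ge0 _).
  by apply: mulr_ge0 (sqr_ge0 _); rewrite divr_ge0 // ltW.
have c1 : K * L3 <= alpha * (p / 2) := contraction_coef L0 L30 p0 h6 alphaE.
have c2 : K + alpha * (2 * eta ^+ 2 / p) <= 3 / 4 * eta.
  exact: gradient_coef alphaE.
have D0 : 0 <= D := sqr_ge0 _.
have M0 : 0 <= M := sqr_ge0 _.
(* Young with parameter [2 eta / p]: the part of the cross term in [D] then
   costs [p/2], half of the gain in the factor [1 - p]. *)
have y : - (2 * eta) * dot r m <= p / 2 * D + 2 * eta ^+ 2 / p * M.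
  have c0 : 0 < 2 * eta / p by rewrite divr_gt0 // mulr_gt0.
  have := dot_young (- r) m c0; rewrite !dotNl dotNr opprK -!enorm_sqr -/D -/M.
  move/(ler_wpM2l (ltW e0)).
  have -> : eta * ((2 * eta / p)^-1 * D + 2 * eta / p * M) =
     p / 2 * D + 2 * eta ^+ 2 / p * M by field; rewrite !gt_eqF.
  by rewrite (_ : eta * _ = - (2 * eta) * dot r m) //; ring.
have ap0 : 0 <= alpha * (1 - p) by rewrite mulr_ge0 // subr_ge0.
have := ler_wpM2l ap0 y.
have := ler_wpM2l K0 VD.
have := ler_wpM2r D0 c1.
have := ler_wpM2r M0 c2.
have ap : 0 <= alpha * p := mulr_ge0 a0 (ltW p0).
have := mulr_ge0 (mulr_ge0 ap (ltW p0)) D0.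
have B0 : 0 <= 2 * eta ^+ 2 / p.
  by apply: divr_ge0 (ltW p0); apply: mulr_ge0 (sqr_ge0 _).
have := mulr_ge0 ap (mulr_ge0 B0 M0).
lra.
Qed.

(** Raising the three bounds of the stepsize condition to integer powers. *)
Lemma stepsize_bounds (R : realType) (L L3 eta p : R) :
  0 < L -> 0 < L3 -> 0 < eta -> 0 < p ->
  eta <= Num.min (1 / (4 * L))
               (Num.min (p `^ (2 / 3) / (36 `^ (1 / 3) * (L * L3) `^ (1 / 3)))
                        (Num.sqrt p / Num.sqrt (6 * L3))) ->
  [/\ 4 * L * eta <= 1, 36 * (L * L3) * eta ^+ 3 <= p ^+ 2
    & 6 * L3 * eta ^+ 2 <= p].
Proof.
move=> L0 L30 e0 p0; rewrite !le_min => /and3P[h1 h2 h3].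
have LL0 : 0 < L * L3 by rewrite mulr_gt0.
have cube (a s : R) : 0 <= a -> (a `^ (s / 3)) ^+ 3 = a `^ s.
  by move=> a_ge0; rewrite -powR_mulrn ?powR_ge0 // -powRrM divfK.
split.
- by rewrite mulrC -ler_pdivlMr // mulr_gt0.
- move: h2; rewrite ler_pdivlMr ?mulr_gt0 ?powR_gt0 // => h2.
  have : (eta * (36 `^ (1 / 3) * (L * L3) `^ (1 / 3))) ^+ 3 <=
         (p `^ (2 / 3)) ^+ 3.
    rewrite lerXn2r ?nnegrE ?powR_ge0 // mulr_ge0 ?(ltW e0) //.
    by rewrite mulr_ge0 ?powR_ge0.
  rewrite !exprMn !cube ?(ltW LL0) ?(ltW p0) //.
  rewrite !powRr1 ?(ltW LL0) // powR_mulrn ?(ltW p0) //.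
  by rewrite mulrC.
- have s0 : 0 < 6 * L3 by rewrite mulr_gt0.
  move: h3; rewrite ler_pdivlMr ?sqrtr_gt0 // => h3.
  have : (eta * Num.sqrt (6 * L3)) ^+ 2 <= (Num.sqrt p) ^+ 2.
    by rewrite lerXn2r ?nnegrE ?mulr_ge0 ?sqrtr_ge0 // ltW.
  by rewrite exprMn !sqr_sqrtr ?(ltW s0) ?(ltW p0) // mulrC.
Qed.

(** * The sampled direction *)

Lemma law_ge0 (R : realType) (n : nat) (S : sampling R n) (s : outcome S) :
  valid_sampling S -> 0 <= law s.
Proof.
case: S s => [q th|tau pt] s; first by case=> h _ _; exact: h.
by case=> _ h _; apply: prodr_ge0 => j _; rewrite ltW.
Qed.

Lemma law_sum1 (R : realType) (n : nat) (S : sampling R n) :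
  valid_sampling S -> \sum_(s : outcome S) law s = 1.
Proof.
case: S => [q th [_ h _]|tau pt [_ _ h]] //=.
transitivity (\prod_(j < tau) \sum_i pt i); last by rewrite h big1.
rewrite bigA_distr_bigA /=.
rewrite (reindex (fun g : {ffun 'I_tau -> 'I_n} => [tuple g i | i < tau])) /=.
  by apply: eq_bigr => g _; apply: eq_bigr => j _; rewrite tnth_mktuple.
exists (fun t => [ffun i => tnth t i]) => [g|t] _.
  by apply/ffunP => i; rewrite ffunE tnth_mktuple.
by apply: eq_from_tnth => i; rewrite tnth_mktuple ffunE.
Qed.

Lemma lsvrg_dir_mean (R : realType) (n d : nat) (f : 'I_n -> 'cV[R]_d -> R)
  (S : sampling R n) (x w : 'cV[R]_d) :
  valid_sampling S -> unbiased S -> (forall i, differentiable (f i) x) ->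
  \sum_(s : outcome S) law s *: lsvrg_dir f x w s = grad (avg f) x.
Proof.
move=> hS hu df; rewrite grad_avg //.
under eq_bigr => s _ do rewrite scalerDr.
rewrite big_split /= -scaler_suml law_sum1 // scale1r.
set A := Gmx f x - Gmx f w.
have -> : \sum_(s : outcome S)
    law s *: (n%:R^-1 *: (A *m theta_mx s *m I_mx s *m ones R n)) =
    n%:R^-1 *: (A *m ones R n).
  rewrite -{2}hu mulmxA mulmx_sumr mulmx_suml scaler_sumr.
  apply: eq_bigr => s _.
  by rewrite -scalemxAr -scalemxAl !mulmxA !scalerA mulrC.
by rewrite -scalerDr -mulmxDl subrK.
Qed.

Lemma lsvrg_dir_variance (R : realType) (n d : nat)
  (f : 'I_n -> 'cV[R]_d -> R) (S : sampling R n) (L3 : R) (x w : 'cV[R]_d) :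
  sampling_variance_bound f S L3 -> (forall i, differentiable (f i) x) ->
  \sum_(s : outcome S) law s * enorm (lsvrg_dir f x w s - grad (avg f) x) ^+ 2
  <= L3 * enorm (x - w) ^+ 2.
Proof.
move=> hv df; apply: le_trans (hv x w); rewrite grad_avg // le_eqVlt.
apply/orP; left; apply/eqP; apply: eq_bigr => s _.
rewrite /lsvrg_dir -addrA; congr (_ * enorm (_ + _) ^+ 2).
by rewrite -scalerBr -scalerN -mulmxBl -mulNmx opprB.
Qed.

(** * Conditional expectations of finitely valued variables *)

Lemma measurable_preimage_fin (dT : measure_display) (T : measurableType dT)
  (C : finType) (h : T -> C) (B : set C) :
  (forall c, measurable (h @^-1` [set c])) -> measurable (h @^-1` B).
Proof.
move=> mh.
have -> : h @^-1` B = \bigcup_(c in B) h @^-1` [set c].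
  apply/seteqP; split=> [t Bt|t [c Bc /= e]]; first by exists (h t).
  by rewrite e.
by apply: fin_bigcup_measurable => //; exact: finite_finset.
Qed.

Lemma EFin_comp_fin (T : Type) (R : realType) (C : finType)
  (h : T -> C) (g : C -> R) :
  EFin \o (g \o h) =
  (fun t => \sum_c (g c)%:E * (\1_(h @^-1` [set c]) t)%:E)%E.
Proof.
apply/funext => t; rewrite (bigD1 (h t)) //= big1 => [|c ch].
  by rewrite adde0 indicE mem_set //= mule1.
by rewrite indicE memNset ?mule0 // => /= e; rewrite e eqxx in ch.
Qed.

Lemma integrable_comp_fin (dT : measure_display) (T : measurableType dT)
  (R : realType) (P : probability T R) (C : finType) (h : T -> C) (g : C -> R) :
  (forall c, measurable (h @^-1` [set c])) ->
  P.-integrable setT (EFin \o (g \o h)).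
Proof.
move=> mh; rewrite EFin_comp_fin; apply: integrable_sum => // c _.
by apply: integrableZl => //; exact: integrable_indic.
Qed.

Lemma integral_comp_fin (dT : measure_display) (T : measurableType dT)
  (R : realType) (P : probability T R) (C : finType) (h : T -> C) (g : C -> R)
  (A : set T) : (forall c, measurable (h @^-1` [set c])) -> measurable A ->
  (\int[P]_(t in A) (g (h t))%:E =
   \sum_c (g c)%:E * P (A `&` h @^-1` [set c]))%E.
Proof.
move=> mh mA.
have iA c : P.-integrable A (fun t => (\1_(h @^-1` [set c]) t)%:E).
  by apply: (integrableS measurableT) => //; exact: integrable_indic.
rewrite -[X in integral _ _ X]/(EFin \o (g \o h)) EFin_comp_fin integral_sum //.
  apply: eq_bigr => c _.
  by rewrite integralZl // integral_indic // setIC.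
by move=> c; apply: integrableZl.
Qed.

Lemma probability_nonempty (dT : measure_display) (T : measurableType dT)
  (R : realType) (P : probability T R) : [set: T] !=set0.
Proof.
apply/set0P/eqP => T0; have := probability_setT P; rewrite T0 measure0 => /eqP.
by rewrite eqe eq_sym oner_eq0.
Qed.

Lemma borel_closed (U : topologicalType) (A : set U) :
  closed A -> <<s @open U >> A.
Proof.
move=> cA; rewrite -[A]setCK -setTD; apply: sigma_algebraCD.
by apply: sub_sigma_algebra; exact: closed_openC.
Qed.

(** Freezing: if [o] is independent of [h] and has law [w], the conditional
    expectation of [phi Z o] given the function [Z] of [h] is obtained by
    averaging over [o] with [Z] held fixed. *)
Lemma cond_exp_freezing (dT : measure_display) (T : measurableType dT)
  (R : realType) (P : probability T R) (U : topologicalType) (H O : finType)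
  (h : T -> H) (o : T -> O) (w : O -> R) (zeta : H -> U)
  (phi : U -> O -> R) :
  accessible_space U ->
  (forall c, measurable (h @^-1` [set c])) ->
  (forall e, measurable (o @^-1` [set e])) ->
  (forall c e, P (h @^-1` [set c] `&` o @^-1` [set e]) =
               (P (h @^-1` [set c]) * (w e)%:E)%E) ->
  is_cond_exp P (zeta \o h) (fun t => phi (zeta (h t)) (o t))
    (fun t => \sum_e w e * phi (zeta (h t)) e).
Proof.
move=> T1 mh mo ind.
pose ho t := (h t, o t).
have hoE c : ho @^-1` [set c] = h @^-1` [set c.1] `&` o @^-1` [set c.2].
  by apply/seteqP; split=> t; rewrite /ho; case: c => c e /=; [case|case=> -> ->].
have mho c : measurable (ho @^-1` [set c]) by rewrite hoE; apply: measurableI.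
pose Y (c : H) := \sum_e w e * phi (zeta c) e.
pose X (c : H * O) := phi (zeta c.1) c.2.
split.
- exact: (integrable_comp_fin P X mho).
- exact: (integrable_comp_fin P Y mh).
- move=> B mB; exists [set zeta c | c in [set c | B (Y c)]].
    have : closed [set zeta c | c in [set c | B (Y c)]].
      apply: (accessible_finite_set_closed.1 T1).
      by apply: finite_image; exact: finite_finset.
    exact: borel_closed.
  rewrite setTI; apply/seteqP; split=> [t /= [c BY e]|t /= BY].
    by rewrite -e.
  by exists (h t).
- move=> A [D _]; rewrite setTI => <-.
  have mD : measurable ((zeta \o h) @^-1` D).
    by rewrite comp_preimage; exact: measurable_preimage_fin.
  rewrite (integral_comp_fin P Y mh mD) (integral_comp_fin P X mho mD).
  transitivity (\sum_c \sum_e (X (c, e))%:E *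
    P ((zeta \o h) @^-1` D `&` ho @^-1` [set (c, e)]))%E; last first.
    by rewrite pair_bigA; apply: eq_bigr => -[].
  apply: eq_bigr => c _.
  have PE e : P ((zeta \o h) @^-1` D `&` ho @^-1` [set (c, e)]) =
      (P ((zeta \o h) @^-1` D `&` h @^-1` [set c]) * (w e)%:E)%E.
    rewrite hoE setIA; have [Dc|Dc] := pselect (D (zeta c)).
      suff -> : (zeta \o h) @^-1` D `&` h @^-1` [set c] = h @^-1` [set c].
        exact: ind.
      by apply/seteqP; split=> [t []|t /= E] //; rewrite E.
    suff -> : (zeta \o h) @^-1` D `&` h @^-1` [set c] = set0.
      by rewrite set0I measure0 mul0e.
    by apply/seteqP; split=> [t [/= + E]|] //; rewrite E.
  have fP : P ((zeta \o h) @^-1` D `&` h @^-1` [set c]) \is a fin_num.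
    by apply: fin_num_measure; exact: measurableI.
  rewrite (eq_bigr _ (fun e _ => congr1 _ (PE e))) -(fineK fP).
  under eq_bigr do rewrite -!EFinM.
  rewrite sumEFin -EFinM mulr_suml; congr (_%:E); apply: eq_bigr => e _.
  by rewrite /X /=; ring.
Qed.

(** Any two versions agree almost surely: a version is constant on each atom
    [Z = v], where its value is determined as soon as the atom has positive
    probability. *)
Lemma cond_exp_unique_fin (dT : measure_display) (T : measurableType dT)
  (R : realType) (P : probability T R) (U : topologicalType) (H : finType)
  (h : T -> H) (zeta : H -> U) (X Y Y' : T -> R) :
  accessible_space U ->
  (forall c, measurable (h @^-1` [set c])) ->
  is_cond_exp P (zeta \o h) X Y -> is_cond_exp P (zeta \o h) X Y' ->
  {ae P, forall t, Y t = Y' t}.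
Proof.
move=> T1 mh [_ _ YZ YX] [_ _ Y'Z Y'X].
pose E c := (zeta \o h) @^-1` [set zeta c].
have mE c : measurable (E c).
  by rewrite /E comp_preimage; exact: measurable_preimage_fin.
have sE c : sigma_of (zeta \o h) (E c).
  exists [set zeta c]; last by rewrite setTI.
  by apply: borel_closed; exact: accessible_closed_set1.
have cst W t t' : (forall B : set R, measurable B ->
    sigma_of (zeta \o h) (W @^-1` B)) -> E (h t) t' -> W t' = W t.
  move=> WZ Et; have [D _] := WZ [set W t] (measurable_set1 _).
  rewrite setTI => DE; have : (W @^-1` [set W t]) t by [].
  by rewrite -DE /= -Et -[D _]/(((zeta \o h) @^-1` D) t') DE.
have atom W t : (forall B : set R, measurable B ->
    sigma_of (zeta \o h) (W @^-1` B)) ->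
    (\int[P]_(u in E (h t)) (W u)%:E = (W t)%:E * P (E (h t)))%E.
  move=> WZ; rewrite -integral_cst //; apply: eq_integral => u.
  by rewrite inE => /(cst _ _ _ WZ) ->.
apply: (@negligibleS _ _ _ _ (\big[setU/set0]_(c | P (E c) == 0%E) E c)).
  move=> t /= ne; suff P0 : P (E (h t)) == 0%E.
    by rewrite (bigD1 (h t)) //=; left.
  apply: contra_notT ne => P0.
  have := YX _ (sE (h t)); rewrite -Y'X // !atom //.
  have fP : P (E (h t)) \is a fin_num by exact: fin_num_measure.
  rewrite -(fineK fP) -!EFinM => -[] /mulIf; apply.
  by apply: contraNneq P0 => f0; rewrite -(fineK fP) f0.
elim/big_ind: _ => [||c /eqP P0]; [exact: negligible_set0|exact: negligibleU|].
exact/negligibleP.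
Qed.

(** * The L-SVRG process *)

(** The law of a coin showing [true] with probability [p]. *)
Definition coin (R : realType) (p : R) (b : bool) : R := if b then p else 1 - p.

Section Randomness.
Context (dT : measure_display) (T : measurableType dT) (R : realType).
Context (P : probability T R) (n : nat) (S : sampling R n) (p : R).
Context (Sk : nat -> T -> outcome S) (bk : nat -> T -> bool).
Hypothesis hrand : lsvrg_randomness P p Sk bk.

Let mb k b : measurable (bk k @^-1` [set b]).
Proof.
by case: hrand => _ + _ _ _; apply; exists [set b] => //; rewrite setTI.
Qed.

Lemma coin_prob k b : P (bk k @^-1` [set b]) = (coin p b)%:E.
Proof.
case: hrand => _ _ _ hb _; case: b => //=; rewrite EFinB -(hb k).
rewrite -probability_setC //; congr (P _); apply/seteqP.
by split=> t /=; case: (bk k t).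
Qed.

(** The joint law of the first [k] draws and coin flips. *)
Lemma history_prob (a : nat -> outcome S * bool) (k : nat) :
  P [set t | forall i, (i < k)%N -> (Sk i t, bk i t) = a i] =
  (\prod_(i < k) (law (a i).1 * coin p (a i).2))%:E.
Proof.
case: (hrand) => _ _ hS _ hind.
pose J : seq (nat + nat) :=
  map inl (iota 0 k) ++ map inr (iota 0 k).
pose A (j : nat + nat) := match j with
  | inl i => Sk i @^-1` [set (a i).1] | inr i => bk i @^-1` [set (a i).2] end.
have -> : [set t | forall i, (i < k)%N -> (Sk i t, bk i t) = a i] =
          \bigcap_(j in [set` J]) A j.
  apply/seteqP; split=> [t ht j|t ht i ik] /=.
    rewrite mem_cat => /orP[] /mapP[i + ->]; rewrite mem_iota => /ht e.
      by rewrite /A /preimage /= -e.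
    by rewrite /A /preimage /= -e.
  have iJ : i \in iota 0 k by rewrite mem_iota.
  have e1 : Sk i t = (a i).1.
    by apply: (ht (inl i)); rewrite /= mem_cat map_f.
  have e2 : bk i t = (a i).2.
    by apply: (ht (inr i)); rewrite /= mem_cat (map_f inr) ?orbT.
  by rewrite e1 e2; case: (a i).
rewrite hind; last first.
- by case=> i _; [exists [set (a i).1]|exists [set (a i).2]]; rewrite // setTI.
- rewrite cat_uniq !map_inj_uniq ?iota_uniq //=; try by move=> ? ? [].
  by rewrite andbT; apply/hasPn => _ /mapP[i _ ->]; apply/mapP => -[].
have Ek : iota 0 k = index_iota 0 k by rewrite /index_iota subn0.
rewrite /J Ek big_cat !big_map !big_mkord /A /=.
under eq_bigr do rewrite hS.
under [X in (_ * X)%E]eq_bigr do rewrite coin_prob.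
by rewrite !prodEFin -EFinM big_split.
Qed.

End Randomness.

Lemma eq_lsvrg (R : realType) (n d : nat) (f : 'I_n -> 'cV[R]_d -> R)
  (S : sampling R n) (eta : R) (x0 : 'cV[R]_d) (s s' : nat -> outcome S)
  (b b' : nat -> bool) (k : nat) :
  (forall i, (i < k)%N -> (s i, b i) = (s' i, b' i)) ->
  lsvrg f eta x0 s b k = lsvrg f eta x0 s' b' k.
Proof.
elim: k => [//|k IH] h /=; rewrite IH => [|i ik]; last by apply: h; exact: ltnW.
by case: (h k (ltnSn k)) => -> ->.
Qed.

Lemma accessible_state (R : realType) (d : nat) :
  accessible_space ('cV[R]_d * 'cV[R]_d)%type.
Proof. by apply: hausdorff_accessible; exact: norm_hausdorff. Qed.

(** The first [k] draws and coin flips. *)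
Definition history (T O : Type) (o : nat -> T -> O) (k : nat) (t : T) :
  {ffun 'I_k -> O} := [ffun i : 'I_k => o i t].

(** A finite history continued by the constant [e] to an infinite sequence. *)
Definition extend (O : Type) (e : O) (k : nat) (c : {ffun 'I_k -> O})
  (i : nat) : O := if insub i is Some j then c j else e.

Lemma extend_lt (O : Type) (e : O) (k : nat) (c : {ffun 'I_k -> O})
  (i : 'I_k) : extend e c i = c i.
Proof. by rewrite /extend valK. Qed.

Lemma extend_ge (O : Type) (e : O) (k : nat) (c : {ffun 'I_k -> O}) :
  extend e c k = e.
Proof. by rewrite /extend insubF // ltnn. Qed.

(** The Lyapunov value after one step from the state [z], with draw [e.1] and
    coin flip [e.2]. *)
Definition next_lyapunov (R : realType) (n d : nat)
  (f : 'I_n -> 'cV[R]_d -> R) (S : sampling R n) (eta alpha : R)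
  (z : 'cV[R]_d * 'cV[R]_d) (e : outcome S * bool) : R :=
  lyapunov (avg f) alpha
    (z.1 - eta *: lsvrg_dir f z.1 z.2 e.1, if e.2 then z.1 else z.2).

(** The averaged one-step bound, a deterministic statement about the state. *)
Lemma mean_next_lyapunov_le (R : realType) (n d : nat)
  (f : 'I_n -> 'cV[R]_d -> R)
  (hdiff : forall i x, differentiable (f i) x)
  (S : sampling R n) (hS : valid_sampling S) (hunb : unbiased S)
  (L L3 eta p : R) (z : 'cV[R]_d * 'cV[R]_d) :
  0 < L -> 0 < L3 -> 0 < eta -> 0 < p -> p <= 1 ->
  smooth L (avg f) -> sampling_variance_bound f S L3 ->
  eta <= Num.min (1 / (4 * L))
               (Num.min (p `^ (2 / 3) / (36 `^ (1 / 3) * (L * L3) `^ (1 / 3)))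
                        (Num.sqrt p / Num.sqrt (6 * L3))) ->
  \sum_(e : outcome S * bool) (law e.1 * coin p e.2) *
     next_lyapunov f eta (3 * eta ^+ 2 * L * L3 / p) z e
  <= lyapunov (avg f) (3 * eta ^+ 2 * L * L3 / p) z
     - eta / 4 * enorm (grad (avg f) z.1) ^+ 2.
Proof.
case: z => x w L0 L30 e0 p0 p1 sF hv.
move=> /(stepsize_bounds L0 L30 e0 p0)[h4 h36 h6].
have := lyapunov_decrease (fun z => differentiable_avg (hdiff^~ z)) sF L0 L30
  e0 p0 p1 h4 h36 h6 (fun s => law_ge0 s hS) (law_sum1 hS)
  (lsvrg_dir_mean w hS hunb (hdiff^~ x)) (lsvrg_dir_variance w hv (hdiff^~ x))
  erefl.
apply: le_trans.
rewrite -(pair_bigA _ (fun s b => (law s * coin p b) *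
  next_lyapunov f eta (3 * eta ^+ 2 * L * L3 / p) (x, w) (s, b))) /=.
apply: ler_sum => s _.
rewrite big_bool /coin /next_lyapunov /=.
set X := lyapunov _ _ _; set Y := lyapunov _ _ _.
by rewrite [leRHS]mulrDr (mulrA _ p X) (mulrA _ (1 - p) Y).
Qed.

Section StateProcess.
Context (R : realType) (n d : nat) (f : 'I_n -> 'cV[R]_d -> R).
Context (S : sampling R n) (eta p alpha : R) (x0 : 'cV[R]_d).
Context (dT : measure_display) (T : measurableType dT) (P : probability T R).
Context (Sk : nat -> T -> outcome S) (bk : nat -> T -> bool).
Hypothesis hrand : lsvrg_randomness P p Sk bk.

Let o k t := (Sk k t, bk k t).
Let z k t := lsvrg f eta x0 (Sk^~ t) (bk^~ t) k.
(* [zeta e k] computes the [k]-th state from the history; it only reads the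
   first [k] entries, so the filler [e] is irrelevant. *)
Let zeta (e : outcome S * bool) k (c : {ffun 'I_k -> outcome S * bool}) :=
  lsvrg f eta x0 (fun i => (extend e c i).1) (fun i => (extend e c i).2) k.

Let zE e k : z k = zeta e (k := k) \o history o k.
Proof.
apply/funext => t; apply: eq_lsvrg => i ik.
by rewrite (extend_lt e (history o k t) (Ordinal ik)) ffunE.
Qed.

Lemma measurable_draw k e : measurable (o k @^-1` [set e]).
Proof.
case: hrand => mS mb _ _ _.
have -> : o k @^-1` [set e] = Sk k @^-1` [set e.1] `&` bk k @^-1` [set e.2].
  apply/seteqP; split=> t; rewrite /o /=; first by move=> <-.
  by case: e => s b [/= -> ->].
apply: measurableI.
  by apply: mS; exists [set e.1] => //; rewrite setTI.
by apply: mb; exists [set e.2] => //; rewrite setTI.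
Qed.

Lemma measurable_history k c : measurable (history o k @^-1` [set c]).
Proof.
have -> : history o k @^-1` [set c] =
    \bigcap_(i in [set: 'I_k]) (o i @^-1` [set c i]).
  apply/seteqP; split=> [t /= <- i _|t h]; first by rewrite /= ffunE.
  by apply/ffunP => i; rewrite ffunE; exact: h.
apply: fin_bigcap_measurable => [|i _]; first exact: finite_finset.
exact: measurable_draw.
Qed.

Lemma history_draw_indep k c e :
  P (history o k @^-1` [set c] `&` o k @^-1` [set e]) =
  (P (history o k @^-1` [set c]) * (law e.1 * coin p e.2)%:E)%E.
Proof.
have hE : history o k @^-1` [set c] =
    [set t | forall i, (i < k)%N -> o i t = extend e c i].
  apply/seteqP; split=> [t /= <- i ik|t h].
    by rewrite (extend_lt e (history o k t) (Ordinal ik)) ffunE.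
  by apply/ffunP => i; rewrite ffunE (h _ (ltn_ord i)) extend_lt.
have -> : history o k @^-1` [set c] `&` o k @^-1` [set e] =
    [set t | forall i, (i < k.+1)%N -> o i t = extend e c i].
  (* The filler is chosen to be [e], so that it sits at position [k]. *)
  rewrite hE; apply/seteqP; split=> [t [/= h1 h2] i|t /= h].
    rewrite ltnS leq_eqVlt => /predU1P[->|]; last exact: h1.
    by rewrite extend_ge.
  split=> [i ik|]; first by apply: h; exact: ltnW.
  by rewrite /= h // extend_ge.
by rewrite hE !(history_prob hrand) big_ord_recr /= extend_ge EFinM.
Qed.

Lemma lyapunov_cond_exp k :
  is_cond_exp P (z k) (fun t => lyapunov (avg f) alpha (z k.+1 t))
    (fun t => \sum_(e : outcome S * bool) (law e.1 * coin p e.2) *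
       next_lyapunov f eta alpha (z k t) e).
Proof.
have [t0 _] := probability_nonempty P.
have -> : (fun t => lyapunov (avg f) alpha (z k.+1 t)) =
          (fun t => next_lyapunov f eta alpha (z k t) (o k t)).
  by apply/funext => t; rewrite /z /=; case: (lsvrg _ _ _ _ _ k).
rewrite (zE (o 0 t0)).
apply: (cond_exp_freezing _ (next_lyapunov f eta alpha)
  (@accessible_state R d)).
- exact: measurable_history.
- exact: measurable_draw.
- exact: history_draw_indep.
Qed.

Lemma lyapunov_cond_exp_unique k X Y Y' :
  is_cond_exp P (z k) X Y -> is_cond_exp P (z k) X Y' ->
  {ae P, forall t, Y t = Y' t}.
Proof.
have [t0 _] := probability_nonempty P.
rewrite (zE (o 0 t0)).
exact: (cond_exp_unique_fin (@accessible_state R d) (measurable_history (k:=k))).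
Qed.

End StateProcess.

Unset Implicit Arguments.

Theorem theorem5p1 (R : realType) (n d : nat) (hn : (0 < n)%N)
  (f : 'I_n -> 'cV[R]_d -> R)
  (hdiff : forall i x, differentiable (f i) x)
  (hmin : exists xs, forall x, avg f xs <= avg f x)
  (S : sampling R n) (hS : valid_sampling S) (hunb : unbiased S)
  (Lf L3 eta p : R) (hLf : 0 < Lf) (hL3 : 0 < L3) (heta : 0 < eta)
  (hp0 : 0 < p) (hp1 : p <= 1)
  (hsmooth : smooth Lf (avg f))
  (hvar : sampling_variance_bound f S L3)
  (heta_le : eta <= Num.min (1 / (4 * Lf))
               (Num.min (p `^ (2 / 3) / (36 `^ (1 / 3) * (Lf * L3) `^ (1 / 3)))
                        (Num.sqrt p / Num.sqrt (6 * L3))))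
  (dT : measure_display) (T : measurableType dT) (P : probability T R)
  (Sk : nat -> T -> outcome S) (bk : nat -> T -> bool)
  (hrand : lsvrg_randomness P p Sk bk) (x0 : 'cV[R]_d) :
  let z k t := lsvrg f eta x0 (Sk^~ t) (bk^~ t) k in
  let alpha := 3 * eta ^+ 2 * Lf * L3 / p in
  let Psi k t := lyapunov (avg f) alpha (z k t) in
  forall k : nat,
    (exists Y, is_cond_exp P (z k) (Psi k.+1) Y) /\
    (forall Y, is_cond_exp P (z k) (Psi k.+1) Y ->
       {ae P, forall t,
          Y t <= Psi k t - eta / 4 * enorm (grad (avg f) (z k t).1) ^+ 2}).
Proof.
move=> z alpha Psi k.
have ce := lyapunov_cond_exp f eta alpha x0 hrand k.
split=> [|Y hY]; first by eexists; exact: ce.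
have := lyapunov_cond_exp_unique hrand hY ce.
apply: filterS => t ->; exact: mean_next_lyapunov_le.
Qed.
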